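(* Let $c\ge 1$ and $n_1\ge n_2\ge\cdots\ge n_c\ge 1$ be integers. Let $G$ be a complete graph on $n$ vertices, where $n\ge n_1+\sum_{i=1}^{c}(n_i-1)$, whose edges are each colored with one of the colors $1,2,\ldots,c$. Suppose that for every $i\in\{1,\ldots,c\}$, $G$ contains no matching consisting of $n_i$ edges all of color $i$. Then $n=n_1+\sum_{i=1}^{c}(n_i-1)$, and the colors of $G$ can be relabeled so that: (a) $V(G)$ can be partitioned into $c$ parts $V_1,V_2,\ldots,V_c$ with $|V_1|=2n_1-1$ and $|V_i|=n_i-1$ for $i\in\{2,\ldots,c\}$, such that all edges with both ends in $V_i$ have color $i$, for each $i\in\{1,\ldots,c\}$; (b) for each $i\in\{2,\ldots,c\}$, all edges with one end in $V_1$ and the other end in $V_i$ have color $i$; (c) for distinct $i,j\in\{2,\ldots,c\}$, every edge with one end in $V_i$ and the other end in $V_j$ has color $i$ or color $j$.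
   Context: All graphs are finite and simple. $n_iK_2$ denotes a matching of size $n_i$ (i.e., $n_i$ pairwise vertex-disjoint edges). A $c$-edge-coloring assigns to each edge one of $c$ colors; colors need not all be used. *)

(* Defs.v *)
From mathcomp Require Import all_boot all_fingroup.

Set Implicit Arguments.
Unset Strict Implicit.
Unset Printing Implicit Defensive.

Definition complete_edges (T : finType) : {set {set T}} :=
  [set e : {set T} | #|e| == 2].

(* Colors 1, ..., c are represented by 'I_c, so color k is the ordinal of value
   k - 1. Only the values on [complete_edges T] matter; a coloring may take
   arbitrary values on the other sets of vertices, and nothing below ever
   inspects them. *)
Definition edge_coloring (T : finType) (c : nat) := {set T} -> 'I_c.

Definition is_matching (T : finType) (M : {set {set T}}) : bool :=
  (M \subset complete_edges T) && trivIset M.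

Definition has_mono_matching (T : finType) (c : nat) (f : edge_coloring T c)
    (i : 'I_c) (k : nat) : Prop :=
  exists M : {set {set T}},
    [/\ is_matching M, #|M| = k & forall e, e \in M -> f e = i].

Definition relabel (T : finType) (c : nat) (s : {perm 'I_c})
    (f : edge_coloring T c) : edge_coloring T c :=
  fun e => s (f e).

(* [finset.partition] forbids empty blocks, whereas the parts of an indexed
   partition may be empty here (a part of size n_i - 1 with n_i = 1). *)
Definition partition_family (T : finType) (c : nat) (V : 'I_c -> {set T}) :
    Prop :=
  (forall i j : 'I_c, i != j -> [disjoint V i & V j]) /\
  \bigcup_(i < c) V i = [set: T].

(* Main.v *)
(** For each color [i], Tutte-Berge yields a set [S i] and an equivalence
    relation [r i] such that every edge of color [i] avoiding [S i] joins related
    vertices, while [r i] relates at most [2 m (2 m + 1)] ordered pairs, where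
    [m = m i = n i - 1 - #|S i|]. The complement [U] of the union of the [S i]
    has more than [n 1 - 1 + \sum_i m i] vertices and all its pairs are related
    by some [r i]; counting pairs forces a single nonzero [m i] (when [n 1 > 1]),
    with [m i = n 1 - 1] and [#|U| = 2 n 1 - 1]. All the inequalities are then
    equalities: [U] is [V 1], the [S j] are the other parts, and the colors [1]
    and [i], which satisfy [n i = n 1], are exchanged. *)
Require Import Defs.
From mathcomp Require Import all_boot all_fingroup.
From mathcomp Require Import zify.

(** * Maximum matchings, Gallai's lemma and a weak Tutte-Berge formula *)

Section Matchings.

Variable T : finType.
Implicit Types (E M N : {set {set T}}) (e : {set T}) (x y u v t : T) (k : nat).

Lemma card_cover_matching M : is_matching M -> #|cover M| = 2 * #|M|.
Proof.
case/andP=> /subsetP sM /eqP <-.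
rewrite (eq_bigr (fun=> 2)) ?sum_nat_const 1?mulnC // => e /sM.
by rewrite inE => /eqP.
Qed.

Lemma sub_matching M N : M \subset N -> is_matching N -> is_matching M.
Proof.
move=> sMN /andP[sN tN]; apply/andP; split; first exact: subset_trans sN.
exact: trivIsetS tN.
Qed.

Lemma matchingU1 e M : is_matching M -> e \in complete_edges T ->
  [disjoint e & cover M] -> is_matching (e |: M) /\ e \notin M.
Proof.
move=> /andP[sM tM] ce dM.
have e0 : e != set0 by move: ce; rewrite inE -card_gt0 => /eqP->.
have eM : e \notin M.
  apply/negP=> eM; case/set0Pn: e0 => x xe.
  by have := disjointFr dM xe; rewrite (subsetP (bigcup_sup e eM)).
split=> //; apply/andP; split.
  by rewrite subUset sub1set ce.
apply/trivIsetP=> A B; rewrite !in_setU1.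
have dis B' : B' \in M -> [disjoint e & B'].
  by move=> BM; apply: disjointWr dM; exact: bigcup_sup.
move=> /orP[/eqP->|AM] /orP[/eqP->|BM].
- by rewrite eqxx.
- by move=> _; exact: dis.
- by move=> _; rewrite disjoint_sym; exact: dis.
- by move/trivIsetP: tM; apply.
Qed.

Definition k_matching E k M := [&& is_matching M, M \subset E & #|M| == k].

(** With [k] the maximum size of a matching in [E], this relation stands in for connectivity in
    Gallai's lemma; the diagonal is added so that it can be an equivalence. *)
Definition jointly_covered E k : rel T := fun x y =>
  (x == y) || [forall M, k_matching E k M ==> (x \in cover M) || (y \in cover M)].

(** A [k]-matching missing both ends could be enlarged by the edge. *)
Lemma jointly_covered_edge E k x y :
  (forall M, ~~ k_matching E k.+1 M) ->
  [set x; y] \in E -> jointly_covered E k x y.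
Proof.
move=> maxk xyE; rewrite /jointly_covered; have [//|xy /=] := eqVneq x y.
apply/forallP=> M; apply/implyP=> /and3P[mM sM /eqP cM].
apply: contraR (maxk ([set x; y] |: M)); rewrite negb_or => /andP[xM yM].
have [||m' nM] := matchingU1 [set x; y] M mM.
- by rewrite inE cards2 xy.
- rewrite disjoints_subset; apply/subsetP=> z; rewrite !inE.
  by case/orP=> /eqP->.
by rewrite /k_matching m' subUset sub1set xyE sM cardsU1 nM cM /=.
Qed.

(* Gallai's lemma: the exchange argument of its usual proof, with the distance
   between the two missed vertices replaced by transitivity. *)
Lemma jointly_covered_trans E k :
  (forall M, ~~ k_matching E k.+1 M) ->
  (forall v, exists2 M, k_matching E k M & v \notin cover M) ->
  transitive (jointly_covered E k).
Proof.
move=> maxk missed t u v; rewrite /jointly_covered.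
have [->//|ut /= Hut] := eqVneq u t.
have [<-|tv /= Htv] := eqVneq t v; first by rewrite Hut orbT.
have [//|uv /=] := eqVneq u v.
apply/forallP=> M; apply/implyP=> kM; apply: contraT.
rewrite negb_or => /andP[uM vM].
have tM : t \in cover M.
  by have := forallP Hut M; rewrite kM (negbTE uM).
(* Here [M] misses [u] and [v], hence covers [t]. Among the [k]-matchings missing [t], [N] is taken
   to share the most edges with [M]. *)
have [N0 kN0 tN0] := missed t.
have P0 : k_matching E k N0 && (t \notin cover N0) by rewrite kN0.
case: (@arg_maxnP _ N0 (fun N => k_matching E k N && (t \notin cover N))
  (fun N => #|M :&: N|) P0) => N /andP[kN tN] maxN.
have uN : u \in cover N.
  by have := forallP Hut N; rewrite kN (negbTE tN) orbF.
have vN : v \in cover N.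
  by have := forallP Htv N; rewrite kN (negbTE tN).
have /and3P[mM sM /eqP cM] := kM; have /and3P[mN sN /eqP cN] := kN.
(* The covers of [M] and [N] have equal size and [u], [v] lie only in that of [N], so at least two
   vertices lie only in that of [M]; one of them is not [t]. *)
have [x]: exists x, x \in (cover M :\: cover N) :\ t.
  apply/set0Pn; rewrite -card_gt0.
  have := cardsD1 t (cover M :\: cover N); rewrite inE tN tM /=.
  have := cardsID (cover N) (cover M); have := cardsID (cover M) (cover N).
  rewrite setIC !card_cover_matching // cM cN.
  have : #|[set u; v]| <= #|cover N :\: cover M|.
    apply/subset_leq_card/subsetP=> z; rewrite !inE.
    by case/orP=> /eqP->; rewrite ?uM ?vM.
  by rewrite cards2 uv /=; clear; lia.
rewrite !inE => /and3P[xt xN /bigcupP[e eM xe]].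
have ce : e \in complete_edges T by case/andP: mM => /subsetP/(_ e eM).
have [y yx De]: exists2 y, y != x & e = [set x; y].
  move: ce; rewrite inE => /cards2P[a [b [ab De]]].
  move: xe; rewrite De !inE => /orP[]/eqP->; first by exists b; rewrite // eq_sym.
  by exists a; rewrite // setUC.
have eE := subsetP sM e eM.
have yN : y \in cover N.
  have := jointly_covered_edge E k x y maxk.
  rewrite -De eE /jointly_covered eq_sym (negbTE yx) /= => /(_ isT) /forallP/(_ N).
  by rewrite kN (negbTE xN).
have yt : y != t by apply: contraNneq tN => <-.
(* Replacing [g] by [e] in [N] still misses [t] but gains an edge of [M], against the choice of
   [N]. *)
have [g gN yg] := bigcupP yN.
have gM : g \notin M.
  apply: contra xN => gM; apply/bigcupP; exists g => //.
  suff <- : e = g by [].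
  apply: contraTeq yg => eg; case/andP: mM => _ /trivIsetP/(_ e g eM gM eg) de.
  by rewrite (disjointFr de) // De !inE eqxx orbT.
have eN : e \notin N.
  by apply: contra xN => eN; apply/bigcupP; exists e.
have [|||mN' eN'] := matchingU1 e (N :\ g).
- exact: sub_matching (subsetDl _ _) mN.
- exact: ce.
- rewrite disjoints_subset De; apply/subsetP=> z; rewrite !inE => /orP[]/eqP->.
    by apply: contra xN => /bigcupP[h]; rewrite !inE => /andP[_ hN] xh; apply/bigcupP; exists h.
  apply/bigcupP=> -[h]; rewrite !inE => /andP[hg hN] yh.
  case/andP: mN => _ /trivIsetP/(_ h g hN gN hg) dh.
  by rewrite (disjointFr dh yh) in yg.
have : k_matching E k (e |: (N :\ g)) && (t \notin cover (e |: (N :\ g))).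
  apply/andP; split.
    apply/and3P; split=> //.
      by rewrite subUset sub1set eE (subset_trans (subsetDl _ _)).
    by rewrite cardsU1 eN' -cN (cardsD1 g N) gN.
  apply/bigcupP=> -[h]; rewrite !inE => /orP[/eqP->|/andP[_ hN]] th.
    by move: th; rewrite De !inE eq_sym (negbTE xt) eq_sym (negbTE yt).
  by case/negP: tN; apply/bigcupP; exists h.
move/maxN; rewrite /= leqNgt => /negP[].
apply: (@leq_trans #|e |: (M :&: N)|).
  by rewrite cardsU1 inE (negbTE eN) andbF add1n.
apply/subset_leq_card/subsetP=> h; rewrite !inE.
case/orP=> [/eqP->|/andP[hM hN]]; first by rewrite eM eqxx.
by rewrite hM hN andbT /= orbC; apply/orP; left; apply: contraNneq gM => <-.
Qed.

(** The diagonal is left out so that the bound [2 * m * (2 * m).+1], the number of such pairs in a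
    single class of [2 * m + 1] vertices, also makes sense for a reflexive [r] with [m = 0]. *)
Definition related_pairs (r : rel T) := [set p : T * T | (p.1 != p.2) && r p.1 p.2].

(** Each class has at most one vertex outside [C], so a vertex has at most as many other related
    vertices as its class has in [C]. Summing over all vertices and exchanging the sums gives the
    class sizes of the elements of [C], each at most [#|C|.+1]. *)
Lemma card_related_pairs (r : rel T) (C : {set T}) :
  symmetric r -> transitive r ->
  {in ~: C &, forall x y, r x y -> x = y} ->
  #|related_pairs r| <= #|C| * #|C|.+1.
Proof.
move=> symr trr rC.
have deg x : #|[set y | (x != y) && r x y]| <= #|[set y in C | r x y]|.
  have [xr|xr] := boolP [exists y, (x != y) && r x y]; last first.
    rewrite (_ : [set y | _] = set0) ?cards0 //; apply/setP=> y; rewrite !inE.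
    by apply: contraNF xr => ?; apply/existsP; exists y.
  have rxx : r x x.
    by case/existsP: xr => y /andP[_ rxy]; apply: (trr y); rewrite // symr.
  have <- : #|[set y | r x y] :\ x| = #|[set y | (x != y) && r x y]|.
    by apply: eq_card => y; rewrite !inE eq_sym.
  have := cardsD1 x [set y | r x y]; rewrite inE rxx.
  have := cardsID C [set y | r x y].
  have -> : #|[set y | r x y] :&: C| = #|[set y in C | r x y]|.
    by apply: eq_card => y; rewrite !inE andbC.
  have : #|[set y | r x y] :\: C| <= 1.
    apply/card_le1_eqP=> a b; rewrite !inE => /andP[aC xa] /andP[bC xb].
    apply: rC; rewrite ?inE //; apply: (trr x); by rewrite // symr.
  clear; lia.
have degC x : #|[set y in C | r x y]| <= #|C|.
  by apply/subset_leq_card/subsetP=> y; rewrite inE => /andP[].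
have le1 : #|related_pairs r| <= \sum_x #|[set y in C | r x y]|.
  apply: (@leq_trans (\sum_x #|[set y | (x != y) && r x y]|)); last first.
    by apply: leq_sum => x _; exact: deg.
  rewrite -sum1_card (eq_bigl (fun p : T * T => (p.1 != p.2) && r p.1 p.2)); last first.
    by move=> p; rewrite inE.
  rewrite -(pair_big_dep xpredT (fun x y => (x != y) && r x y) (fun _ _ => 1)) /=.
  by apply: leq_sum => x _; rewrite -sum1_card; apply: eq_leq; apply: eq_bigl => y; rewrite inE.
apply: leq_trans le1 _.
have -> : \sum_x #|[set y in C | r x y]| = \sum_(y in C) #|[set x | r y x]|.
  rewrite (eq_bigr (fun x => \sum_(y in C | r x y) 1)); last first.
    by move=> x _; rewrite -sum1_card; apply: eq_bigl => y; rewrite inE.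
  rewrite (exchange_big_dep (mem C)) /=; last by move=> x y _ /andP[].
  apply: eq_bigr => y yC; rewrite -sum1_card; apply: eq_bigl => x.
  by rewrite inE symr; apply: andb_idl.
rewrite -sum_nat_const; apply: leq_sum => y yC.
apply: (@leq_trans #|y |: [set x | (y != x) && r y x]|).
  by apply/subset_leq_card/subsetP=> x; rewrite !inE eq_sym; case: eqP.
by rewrite cardsU1 inE eqxx add1n ltnS (leq_trans (deg y)).
Qed.

(* A weak form of the Tutte-Berge formula: the classes of [r] play the role of
   the components of [E] minus [S], and [m] bounds the sum of [|C| %/ 2] over
   the classes [C]. *)
Lemma matching_barrier E k :
  (forall M, ~~ k_matching E k.+1 M) ->
  exists (S : {set T}) (r : rel T) (m : nat),
    [/\ #|S| + m = k, symmetric r /\ transitive r,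
        forall x y, x != y -> [set x; y] \in E -> x \notin S -> y \notin S -> r x y
      & #|related_pairs r| <= 2 * m * (2 * m).+1].
Proof.
elim: k E => [|k IH] E maxk.
  exists set0, (fun _ _ => false), 0; split=> //.
  - by rewrite cards0.
  - move=> x y xy xyE; case/negP: (maxk [set [set x; y]]).
    rewrite /k_matching cards1 sub1set xyE /is_matching sub1set inE cards2 xy /=.
    by rewrite andbT; apply/trivIsetP=> A B /set1P-> /set1P->; rewrite eqxx.
  - by rewrite leqn0 cards_eq0; apply/eqP/setP=> p; rewrite !inE andbF.
(* A vertex [v] in every [k.+1]-matching is deleted and put into the barrier. If there is none,
   Gallai's lemma applies with an empty barrier. *)
have [/existsP[v /forallP vall]|] :=
  boolP [exists v, [forall M, k_matching E k.+1 M ==> (v \in cover M)]].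
  have [|S [r [m [Sm rP rE rm]]]] := IH [set e in E | v \notin e].
    move=> M; apply/negP=> /and3P[mM sM cM].
    have := vall M; rewrite /k_matching mM cM andbT /=.
    rewrite (subset_trans sM); last by apply/subsetP=> e; rewrite inE => /andP[].
    move=> /= /bigcupP[e /(subsetP sM)]; rewrite inE => /andP[_ /negP] //.
  have cS : #|v |: S| <= #|S|.+1 by rewrite cardsU1; case: (v \notin S).
  (* The truncated difference covers the case where [v] is already in [S]; the new [m] is then
     larger, which only weakens the bound. *)
  exists (v |: S), r, (k.+1 - #|v |: S|); split=> //.
  - by rewrite subnKC // (leq_trans cS) // ltnS -Sm leq_addr.
  - move=> x y xy xyE; rewrite !in_setU1 !negb_or => /andP[xv xS] /andP[yv yS].
    by apply: rE; rewrite // inE xyE !inE negb_or ![v == _]eq_sym xv.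
  - apply: leq_trans rm _; have : m <= k.+1 - #|v |: S| by lia.
    by move=> le_m; apply: leq_mul; rewrite ?ltnS leq_mul2l le_m orbT.
rewrite negb_exists => /forallP noall.
have missed v : exists2 M, k_matching E k.+1 M & v \notin cover M.
  have := noall v; rewrite negb_forall => /existsP[M].
  by rewrite negb_imply => /andP[kM vM]; exists M.
have symr : symmetric (jointly_covered E k.+1).
  by move=> x y; rewrite /jointly_covered eq_sym; congr (_ || _);
     apply: eq_forallb => M; rewrite orbC.
exists set0, (jointly_covered E k.+1), k.+1; split.
- by rewrite cards0.
- by split=> //; exact: jointly_covered_trans.
- by move=> x y _ xyE _ _; exact: jointly_covered_edge.
have [v _|noT] := pickP T; last first.
  by rewrite (_ : related_pairs _ = set0) ?cards0 //; apply/setP=> -[x y]; have := noT x.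
have [M kM _] := missed v; have /and3P[mM _ /eqP cM] := kM.
have cov : #|cover M| = 2 * k.+1 by rewrite card_cover_matching ?cM.
rewrite -cov; apply: card_related_pairs => //; first exact: jointly_covered_trans.
move=> x y; rewrite !inE => xM yM /orP[/eqP //|/forallP/(_ M)].
by rewrite kM (negbTE xM) (negbTE yM).
Qed.

End Matchings.

(** * The union bound and its equality case *)

Lemma card_bigcup_leq (T I : finType) (P : pred I) (S : I -> {set T}) :
  #|\bigcup_(i | P i) S i| <= \sum_(i | P i) #|S i|.
Proof.
elim/big_rec2: _ => [|i k A _ le]; first by rewrite cards0.
by rewrite (leq_trans (leq_card_setU _ _)) // leq_add2l.
Qed.

Lemma card_bigcup_disjoint (T I : finType) (S : I -> {set T}) :
  \sum_i #|S i| <= #|\bigcup_i S i| ->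
  forall i j, i != j -> [disjoint S i & S j].
Proof.
move=> le i j ij; rewrite -setI_eq0 -cards_eq0.
have ji : j != i by rewrite eq_sym.
have := le; have -> : \bigcup_k S k =
  S i :|: S j :|: \bigcup_(k | (k != i) && (k != j)) S k.
  by rewrite (bigD1 i) //= (bigD1 j) //= setUA.
rewrite (bigD1 i) // (bigD1 j) //=.
have := card_bigcup_leq T I (fun k => (k != i) && (k != j)) S.
set A := \bigcup_(k | _) _; set B := \sum_(k | _) _.
have := leq_card_setU (S i :|: S j) A; rewrite /leqif => -[+ _].
have := cardsUI (S i) (S j); clear; lia.
Qed.

(** * Covering all pairs of a set by equivalence relations *)

Section Covers.

Variable T : finType.
Implicit Types (U : {set T}) (x y z : T).

Definition offdiag U : {set T * T} :=
  related_pairs T (fun x y => (x \in U) && (y \in U)).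

Lemma card_offdiag U : #|offdiag U| = #|U| * #|U|.-1.
Proof.
rewrite -sum1_card (eq_bigl (fun p : T * T => (p.1 \in U) && (p.2 \in U :\ p.1))).
  rewrite -(pair_big_dep (mem U) (fun x y => y \in U :\ x) (fun _ _ => 1)) /=.
  rewrite -sum_nat_const; apply: eq_bigr => x xU.
  by rewrite sum1_card (cardsD1 x U) xU.
by move=> [x y]; rewrite !inE /= eq_sym andbCA.
Qed.

(** If [r1] fails on [x], [y], then [r2] relates [x] to every other [z]: either directly, or, when
    [r1 x z], through [y], because [r1 z y] would give [r1 x y]. *)
Lemma union_equiv_total U (r1 r2 : rel T) :
  symmetric r1 -> transitive r1 -> symmetric r2 -> transitive r2 ->
  {in U &, forall x y, x != y -> r1 x y || r2 x y} ->
  {in U &, forall x y, x != y -> r1 x y} \/ {in U &, forall x y, x != y -> r2 x y}.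
Proof.
move=> s1 t1 s2 t2 r12.
have [/existsP[x /existsP[y /and4P[xU yU xy nxy]]]|no] := boolP
  [exists x, exists y, [&& x \in U, y \in U, x != y & ~~ r1 x y]]; last first.
  left=> x y xU yU xy; apply: contraR no => nxy.
  by apply/existsP; exists x; apply/existsP; exists y; apply/and4P.
right.
have xyr : r2 x y by have := r12 x y xU yU xy; rewrite (negbTE nxy).
have star z : z \in U -> x != z -> r2 x z.
  move=> zU xz; have [->//|zy] := eqVneq z y.
  have [rxz|nxz] := boolP (r1 x z); last first.
    by have := r12 x z xU zU xz; rewrite (negbTE nxz).
  have nzy : ~~ r1 z y by apply: contra nxy; exact: t1.
  have := r12 z y zU yU zy; rewrite (negbTE nzy) /= => rzy.
  by apply: (t2 y) => //; rewrite s2.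
move=> a b aU bU ab.
have [xa|xa] := eqVneq x a; first by rewrite -xa in ab *; exact: star.
have [xb|xb] := eqVneq x b; first by rewrite -xb s2; exact: star.
by apply: (t2 x); [rewrite s2|]; exact: star.
Qed.

(* [U] is covered by equivalence relations with few related pairs: with
   [u = max m] and [R = \sum m - u], counting the pairs of [U] gives
   [(2u + 1 + R) (2u + R) <= 2 u (2u + 1) + 2 (2u + 1) R], that is [R^2 <= R]. *)
Lemma cover_relations c (i0 : 'I_c) U (r : 'I_c -> rel T) (m : 'I_c -> nat) b :
  (forall i, symmetric (r i) /\ transitive (r i)) ->
  (forall i, #|related_pairs T (r i)| <= 2 * m i * (2 * m i).+1) ->
  (forall x y, x \in U -> y \in U -> x != y -> exists i, r i x y) ->
  (forall i, m i <= b) ->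
  b + \sum_(i < c) m i < #|U| ->
  exists i, [/\ m i = b, forall j, j != i -> m j = 0 & #|U| = (2 * b).+1].
Proof.
move=> rP rm rU mb ltU.
case: (@arg_maxnP _ i0 xpredT m isT) => i _ mi.
have {}mi j : m j <= m i by apply: mi.
set u := m i in mi *; pose R := \sum_(j < c | j != i) m j.
have sumE : \sum_(j < c) m j = u + R by rewrite (bigD1 i).
have [ub NR] : u <= b /\ 2 * u + R < #|U|.
  by split; [exact: mb|]; have := mb i; rewrite -/u; rewrite sumE in ltU; lia.
have le1 : #|U| * #|U|.-1 <= 2 * u * (2 * u).+1 + 2 * R * (2 * u).+1.
  rewrite -card_offdiag; apply: leq_trans (_ : \sum_(j < c) #|related_pairs T (r j)| <= _).
    apply: (@leq_trans #|\bigcup_(j < c) related_pairs T (r j)|).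
      apply/subset_leq_card/subsetP=> -[x y]; rewrite !inE /= => /and3P[xy xU yU].
      have [j rj] := rU x y xU yU xy; apply/bigcupP; exists j => //.
      by rewrite inE /= xy.
    exact: card_bigcup_leq.
  rewrite (bigD1 i) //=; apply: leq_add; first exact: rm.
  rewrite /R big_distrr big_distrl /=; apply: leq_sum => j _.
  by apply: leq_trans (rm j) _; rewrite leq_mul2l ltnS leq_mul2l mi !orbT.
have R1 : R <= 1.
  have le2 : (2 * u + R).+1 * (2 * u + R) <= #|U| * #|U|.-1.
    by apply: leq_mul => //; case: #|U| NR.
  have := leq_trans le2 le1; clear; nia.
case: (posnP R) => [R0|Rgt0].
  exists i; rewrite -/u.
  have m0 j : j != i -> m j = 0.
    by move=> ji; move/eqP: R0; rewrite sum_nat_eq0 => /forall_inP/(_ j ji)/eqP.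
  have le3 : #|U| <= (2 * u).+1.
    move: le1; rewrite R0; case: #|U| => [//|N] /=; clear; nia.
  by split=> //; rewrite sumE R0 in ltU; lia.
(* The case [R = 1] is impossible: only [r i] and [r j] have related pairs, so one of them is total
   on [U], which has at least [2 * u + 2] vertices, too many for the bound. *)
have /sum_nat_eq1[j [ji mj m0]]: R == 1 by rewrite eqn_leq R1 Rgt0.
have le_r k : {in U &, forall x y, x != y -> r k x y} ->
    #|U| * #|U|.-1 <= 2 * u * (2 * u).+1.
  move=> tot; rewrite -card_offdiag.
  apply: (@leq_trans #|related_pairs T (r k)|).
    apply/subset_leq_card/subsetP=> -[x y]; rewrite !inE /= => /and3P[xy xU yU].
    by rewrite xy tot.
  by apply: leq_trans (rm k) _; rewrite leq_mul // ?ltnS leq_mul2l mi.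
have le3 : #|U| * #|U|.-1 <= 2 * u * (2 * u).+1.
  have [si ti] := rP i; have [sj tj] := rP j.
  have [|tot|tot] := union_equiv_total U (r i) (r j) si ti sj tj.
  - move=> x y xU yU xy; have [k] := rU x y xU yU xy.
    have [->->//|ki] := eqVneq k i; have [->->|kj rk] := eqVneq k j; first by rewrite orbT.
    have := rm k; rewrite m0 // leqn0 cards_eq0 => /eqP/setP/(_ (x, y)).
    by rewrite !inE /= xy rk.
  - exact: le_r tot.
  - exact: le_r tot.
have : (2 * u).+2 * (2 * u).+1 <= #|U| * #|U|.-1.
  by apply: leq_mul; case: #|U| NR => // N; lia.
move/leq_trans/(_ le3); clear; nia.
Qed.

End Covers.

(** * The structure of the extremal colorings *)

Theorem theorem1 (c : nat) (hc : 0 < c) (n : 'I_c -> nat)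
    (n_noninc : forall i j : 'I_c, i <= j -> n j <= n i)
    (n_pos : forall i : 'I_c, 1 <= n i)
    (T : finType) (f : edge_coloring T c)
    (hT : n (Ordinal hc) + \sum_(i < c) (n i - 1) <= #|T|)
    (hf : forall i : 'I_c, ~ has_mono_matching f i (n i)) :
  let one := Ordinal hc in
  #|T| = n one + \sum_(i < c) (n i - 1) /\
  exists (s : {perm 'I_c}) (V : 'I_c -> {set T}),
    let g := relabel s f in
    [/\ [/\ partition_family V,
            #|V one| = 2 * n one - 1,
            forall i : 'I_c, i != one -> #|V i| = n i - 1
          & forall (i : 'I_c) (x y : T),
              x \in V i -> y \in V i -> x != y -> g [set x; y] = i],
        forall (i : 'I_c) (x y : T), i != one ->
          x \in V one -> y \in V i -> g [set x; y] = i
      & forall (i j : 'I_c) (x y : T), i != one -> j != one -> i != j ->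
          x \in V i -> y \in V j -> g [set x; y] = i \/ g [set x; y] = j].
Proof.
move=> one.
have [S [r [m HS]]] : exists (S : 'I_c -> {set T}) (r : 'I_c -> rel T) (m : 'I_c -> nat),
    forall i, [/\ #|S i| + m i = n i - 1, symmetric (r i) /\ transitive (r i),
      forall x y, x != y -> f [set x; y] = i -> x \notin S i -> y \notin S i -> r i x y
      & #|related_pairs T (r i)| <= 2 * m i * (2 * m i).+1].
  suff /fin_all_exists[S /fin_all_exists[r /fin_all_exists[m Hm]]] :
    forall i, exists (S : {set T}) (r : rel T) (m : nat),
      [/\ #|S| + m = n i - 1, symmetric r /\ transitive r,
      forall x y, x != y -> f [set x; y] = i -> x \notin S -> y \notin S -> r x y
      & #|related_pairs T r| <= 2 * m * (2 * m).+1].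
    by exists S, r, m.
  move=> i; have [|S [r [m [Sm rP rE rm]]]] := matching_barrier T [set e | f e == i] (n i - 1).
      move=> M; apply/negP=> /and3P[mM /subsetP sM /eqP cM]; apply: (hf i); exists M.
      split=> //; first by rewrite cM subn1 prednK ?n_pos.
      by move=> e /sM; rewrite inE => /eqP.
    exists S, r, m; split=> // x y xy fxy; apply: rE => //.
    by rewrite inE fxy.
have Sm i : #|S i| + m i = n i - 1 by case: (HS i).
have rP i : symmetric (r i) /\ transitive (r i) by case: (HS i).
have rm i : #|related_pairs T (r i)| <= 2 * m i * (2 * m i).+1 by case: (HS i).
have rE i x y : x != y -> f [set x; y] = i -> x \notin S i -> y \notin S i -> r i x y.
  by case: (HS i) => _ _ + _; apply.
clear HS.
have n1 i : n i <= n one by apply: n_noninc.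
pose W := \bigcup_i S i; pose U := ~: W.
have notS x i : x \in U -> x \notin S i.
  by rewrite inE; apply: contra => xi; apply/bigcupP; exists i.
have sumn : \sum_(i < c) (n i - 1) = \sum_(i < c) #|S i| + \sum_(i < c) m i.
  by rewrite -big_split; apply: eq_bigr => i _; rewrite -Sm.
have cW : #|W| <= \sum_(i < c) #|S i| by exact: card_bigcup_leq.
have cWU : #|W| + #|U| = #|T| by exact: cardsC.
have n1pos := n_pos one.
have [i [mi m0 cU]] : exists i, [/\ m i = n one - 1,
    forall j, j != i -> m j = 0 & #|U| = (2 * (n one - 1)).+1].
  apply: (cover_relations T c one U r m) => //.
  - move=> x y xU yU xy; exists (f [set x; y]); apply: rE => //; exact: notS.
  - by move=> i; have := Sm i; have := n1 i; clear; lia.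
  - move: hT cW cWU n1pos sumn; rewrite -/one; clear;
    move: #|T| #|W| #|U| (n one) (\sum_(k < c) (n k - 1)) (\sum_(k < c) #|S k|) (\sum_(k < c) m k) => *; lia.
have summ : \sum_(j < c) m j = n one - 1.
  by rewrite (bigD1 i) //= mi big1 ?addn0.
(* Both follow from [n one - 1 = m i <= n i - 1 <= n one - 1]. *)
have [Si ni] : #|S i| = 0 /\ n i = n one.
  by have := Sm i; have := n1 i; have := n_pos i; rewrite mi; clear -n1pos; lia.
have cT : #|T| = n one + \sum_(i < c) (n i - 1).
  by move: hT cW cWU n1pos sumn; rewrite summ cU -/one; clear;
    move: #|T| #|W| (n one) (\sum_(k < c) (n k - 1)) (\sum_(k < c) #|S k|) => *; lia.
(* The exact value of [#|T|] makes the union bound on [W] an equality. *)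
have disS : forall j k, j != k -> [disjoint S j & S k].
  apply: card_bigcup_disjoint; rewrite -/W.
  by move: cT cWU n1pos sumn; rewrite summ cU; clear;
    move: #|T| #|W| (n one) (\sum_(k < c) (n k - 1)) (\sum_(k < c) #|S k|) => *; lia.
have Si0 x : x \notin S i by move/eqP: Si; rewrite cards_eq0 => /eqP->; rewrite inE.
have r0 j x y : x != y -> j != i -> ~~ r j x y.
  move=> xy /m0 mj; have := rm j; rewrite mj leqn0 cards_eq0 => /eqP/setP/(_ (x, y)).
  by rewrite !inE /= xy => /negbT.
have U_ri x y : x != y -> x \in U -> y \in U -> f [set x; y] = i /\ r i x y.
  move=> xy xU yU; have rxy := rE _ x y xy erefl (notS _ _ xU) (notS _ _ yU).
  by have [fi|/(r0 _ _ _ xy)/negP] := eqVneq (f [set x; y]) i; rewrite // -fi.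
(* The pairs of [U] already exhaust the bound on [r i], so [r i] relates no pair leaving [U]. Hence
   every edge not inside [U] has an end in the barrier of its own color. *)
have offU : offdiag T U = related_pairs T (r i).
  apply/eqP; rewrite eqEcard card_offdiag cU -mi /= mulnC rm andbT.
  apply/subsetP=> -[x y]; rewrite !inE /= => /and3P[xy xU yU]; rewrite xy.
  by have [] := U_ri x y xy; rewrite ?inE.
have edge_notS x y : x != y -> x \notin S (f [set x; y]) -> y \notin S (f [set x; y]) ->
    [/\ f [set x; y] = i, x \in U & y \in U].
  move=> xy xS yS; have rxy := rE _ x y xy erefl xS yS.
  have [fi|/(r0 _ _ _ xy)/negP//] := eqVneq (f [set x; y]) i.
  move/setP: offU => /(_ (x, y)); rewrite !inE /= xy -fi rxy /= => /andP[xU yU].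
  by split; rewrite ?inE.
have edgeS x y : x != y -> x \notin U -> x \in S (f [set x; y]) \/ y \in S (f [set x; y]).
  move=> xy xU; have [|xS] := boolP (x \in S (f [set x; y])); first by left.
  have [|yS] := boolP (y \in S (f [set x; y])); first by right.
  by have [_] := edge_notS x y xy xS yS; rewrite (negbTE xU).
have S_inj j k x : x \in S j -> x \in S k -> j = k.
  move=> xj xk; apply: contraTeq isT => jk.
  by have := disjointFr (disS j k jk) xj; rewrite xk.
have SU j x : x \in S j -> x \notin U by move=> xj; apply: contraL xj; exact: notS.
split=> //.
pose s := tperm one i.
have ss j : s (s j) = j by exact: tpermK.
have s_one : s one = i by exact: tpermL.
have si : s i = one by exact: tpermR.
have neq1 j : (j != one) = (s j != i) by rewrite -s_one (inj_eq perm_inj).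
have ns j : n (s j) = n j.
  by rewrite /s; case: tpermP => [->|->|].
(* The only barrier not among the parts is [S (s one) = S i], which is empty. *)
exists s, (fun j => if j == one then U else S (s j)); rewrite /relabel /=; split.
- split.
  + split.
      move=> j k jk; case: eqP => [j1|_]; case: eqP => [k1|_].
      * by rewrite j1 k1 eqxx in jk.
      * by rewrite disjoint_sym disjoints_subset; apply/subsetP=> x /SU xU; rewrite in_setC.
      * by rewrite disjoints_subset; apply/subsetP=> x /SU xU; rewrite in_setC.
      * by apply: disS; rewrite (inj_eq perm_inj).
    apply/setP=> x; rewrite inE; apply/bigcupP.
    have [xU|] := boolP (x \in U); first by exists one; rewrite ?eqxx.
    rewrite inE negbK => /bigcupP[j _ xj]; exists (s j); rewrite // ss.
    by case: eqP => // sj1; move: (Si0 x); rewrite -s_one -sj1 ss xj.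
  + by rewrite ?eqxx cU; move: n1pos; rewrite -/one; clear; lia.
  + move=> j j1; rewrite (negbTE j1) -ns -Sm m0 ?addn0 //.
    by rewrite -neq1.
  + move=> j x y; case: eqP => [-> xU yU xy|_ xS yS xy].
      by have [-> _] := U_ri x y xy xU yU.
    (* An end of the edge lies in the barrier of its color; as the barriers are disjoint, this color
       is the index of the barrier containing that end. Parts (b) and (c) use the same argument. *)
    by case: (edgeS x y xy (SU _ _ xS)) => [/(S_inj _ _ _ xS)|/(S_inj _ _ _ yS)] <-.
- move=> j x y j1; rewrite ?eqxx (negbTE j1) => xU yS.
  have yU := SU _ _ yS.
  have yx : y != x by apply: contraNneq yU => ->.
  rewrite setUC; case: (edgeS y x yx yU) => [/(S_inj _ _ _ yS) <-//|].
  by rewrite (negbTE (notS _ _ xU)).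
- move=> j k x y j1 k1 jk; rewrite (negbTE j1) (negbTE k1) => xS yS.
  have xy : x != y.
    apply: contra jk => /eqP xy; rewrite -(inj_eq (@perm_inj _ s)); apply/eqP.
    by apply: (S_inj _ _ x); rewrite // xy.
  by case: (edgeS x y xy (SU _ _ xS)) => [/(S_inj _ _ _ xS)|/(S_inj _ _ _ yS)] <-;
    rewrite ss; [left|right].
Qed.
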